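(* Let $D$ be a sharp domain and let $x, y$ be two nonzero $v$-coprime elements of $D$. Then $xD + yD = D$.
   Context: All rings are integral domains (commutative, unitary, without zero-divisors). A domain $D$ is called a sharp domain if whenever $I \supseteq AB$ with $I, A, B$ nonzero ideals of $D$, there exist ideals $A' \supseteq A$ and $B' \supseteq B$ of $D$ such that $I = A'B'$. Let $K$ be the quotient field of $D$. For a nonzero fractional ideal $I$ of $D$, put $I^{-1} = \{x \in K \mid xI \subseteq D\}$; the $v$-closure of $I$ is $I_v = (I^{-1})^{-1}$. Two nonzero elements $x, y$ of $D$ are $v$-coprime if $(xD + yD)_v = D$; equivalently, $xD \cap yD = xyD$. *)

(* Defs.v *)
From HB Require Import structures.
From mathcomp Require Import all_boot all_order all_algebra.
From mathcomp Require Import boolp classical_sets.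

Set Implicit Arguments.
Unset Strict Implicit.
Unset Printing Implicit Defensive.

Import GRing.Theory.
Local Open Scope ring_scope.
Local Open Scope classical_set_scope.

(* Ideals are arbitrary classical sets and need not be proper: idealr in
   ring_quotient covers only decidable proper ideals, whereas the factors
   in a sharp domain may be the whole ring. *)
Definition is_ideal (D : idomainType) (I : set D) : Prop :=
  [/\ I 0,
      forall a b : D, I a -> I b -> I (a + b) &
      forall r a : D, I a -> I (r * a)].

Definition nonzero_ideal (D : idomainType) (I : set D) : Prop :=
  is_ideal I /\ I <> [set 0].

Definition principal_ideal (D : idomainType) (x : D) : set D :=
  [set x * r | r in [set: D]].

Definition ideal_add (D : idomainType) (A B : set D) : set D :=
  [set a + b | a in A & b in B].

Definition ideal_mul (D : idomainType) (A B : set D) : set D :=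
  [set z | exists (n : nat) (a b : 'I_n -> D),
     (forall i : 'I_n, A (a i) /\ B (b i)) /\ z = \sum_(i < n) a i * b i].

Definition sharp_domain (D : idomainType) : Prop :=
  forall I A B : set D,
    nonzero_ideal I -> nonzero_ideal A -> nonzero_ideal B ->
    ideal_mul A B `<=` I ->
    exists A' B' : set D,
      [/\ is_ideal A', is_ideal B', A `<=` A', B `<=` B' &
          I = ideal_mul A' B'].

Definition frac_image (D : idomainType) (I : set D) : set {fraction D} :=
  @FracField.tofrac D @` I.

(* Meaningful for nonzero fractional ideals J; the formula makes sense for
   any subset of the quotient field. *)
Definition frac_inv (D : idomainType) (J : set {fraction D}) :
    set {fraction D} :=
  [set z | forall j, J j -> frac_image [set: D] (z * j)].

Definition v_closure (D : idomainType) (J : set {fraction D}) :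
    set {fraction D} :=
  frac_inv (frac_inv J).

Definition v_coprime (D : idomainType) (x y : D) : Prop :=
  v_closure (frac_image (ideal_add (principal_ideal x) (principal_ideal y)))
  = frac_image [set: D].

(* Main.v *)
Require Import Defs.
From mathcomp Require Import all_boot all_order all_algebra.
From mathcomp Require Import boolp classical_sets.
From mathcomp Require Import ring.
Local Open Scope ring_scope.
Local Open Scope classical_set_scope.

(** The $v$-coprimality of [x] and [y] enters only through cancellation: modulo
    either of the two elements, the other one is not a zero-divisor
    ([v_coprime_cancell], [v_coprime_cancelr]).  Write J = (x, y) and apply
    sharpness to I = (x^2, y), which contains J J: this gives I = A' B' with A'
    and B' both containing J.  If a is in A', then a x is in A' B' = (x^2, y),
    and cancelling x modulo y yields a in J ([v_coprime_colon_sub]).  Hence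
    A' = J, likewise B' = J, so (x^2, y) = J^2.  In particular y lies in J^2,
    which is contained in (x, y^2); thus y (1 - s y) is in xD for some s, and
    cancelling y modulo x gives 1 in (x, y). *)

Import GRing.Theory.

Lemma principal_ideal_is_ideal {D : idomainType} (x : D) :
  is_ideal (principal_ideal x).
Proof.
split.
- by exists 0; rewrite ?mulr0.
- by move=> _ _ [r _ <-] [s _ <-]; exists (r + s); rewrite ?mulrDr.
- by move=> r _ [s _ <-]; exists (r * s); rewrite // mulrCA.
Qed.

Lemma ideal_add_is_ideal {D : idomainType} {A B : set D} :
  is_ideal A -> is_ideal B -> is_ideal (ideal_add A B).
Proof.
move=> [A0 AD AM] [B0 BD BM]; split.
- by exists 0 => //; exists 0; rewrite ?addr0.
- move=> _ _ [a Aa [b Bb <-]] [c Ac [d Bd <-]].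
  by exists (a + c); [exact: AD|exists (b + d); [exact: BD|rewrite addrACA]].
- move=> r _ [a Aa [b Bb <-]].
  by exists (r * a); [exact: AM|exists (r * b); [exact: BM|rewrite mulrDr]].
Qed.

Lemma ideal_pairP {D : idomainType} (x y z : D) :
  ideal_add (principal_ideal x) (principal_ideal y) z <->
  exists r s, z = x * r + y * s.
Proof.
split=> [[_ [r _ <-] [_ [s _ <-] <-]]|[r [s ->]]]; first by exists r, s.
by exists (x * r); [exists r|exists (y * s); [exists s|]].
Qed.

Lemma ideal_pair_is_ideal {D : idomainType} (x y : D) :
  is_ideal (ideal_add (principal_ideal x) (principal_ideal y)).
Proof. by apply: ideal_add_is_ideal; apply: principal_ideal_is_ideal. Qed.

Lemma ideal_pair_nonzero {D : idomainType} (x y : D) :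
  y != 0 -> nonzero_ideal (ideal_add (principal_ideal x) (principal_ideal y)).
Proof.
move=> y0; split; first exact: ideal_pair_is_ideal.
move=> E; have : ideal_add (principal_ideal x) (principal_ideal y) y.
  by apply/ideal_pairP; exists 0, 1; ring.
by rewrite E => /= yE; rewrite yE eqxx in y0.
Qed.

Lemma ideal_mul_sub {D : idomainType} (A B I : set D) :
  is_ideal I -> (forall a b, A a -> B b -> I (a * b)) ->
  ideal_mul A B `<=` I.
Proof.
move=> [I0 ID _] AB _ [n [a [b [ab ->]]]].
by apply: big_ind => // i _; have [] := ab i; apply: AB.
Qed.

Lemma mem_ideal_mul {D : idomainType} (A B : set D) (a b : D) :
  A a -> B b -> ideal_mul A B (a * b).
Proof.
by move=> Aa Bb; exists 1%N, (fun=> a), (fun=> b); rewrite big_ord1.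
Qed.

(** Such a [z] lies in the inverse of the fractional ideal (x, y), and 1 belongs
    to the inverse of that inverse. *)
Lemma v_coprime_integral {D : idomainType} (x y : D) (z : {fraction D}) :
  v_coprime x y ->
  frac_image [set: D] (z * FracField.tofrac x) ->
  frac_image [set: D] (z * FracField.tofrac y) -> frac_image [set: D] z.
Proof.
move=> xy [p _ zx] [q _ zy]; rewrite -[z]mul1r.
have : frac_image [set: D] 1 by exists 1; rewrite // rmorph1.
rewrite -{1}xy; apply=> _ [_ /ideal_pairP[r [s ->]] <-].
exists (p * r + q * s) => //.
by rewrite !rmorphD !rmorphM /= zx zy mulrDr !mulrA.
Qed.

(** The fraction t / y is multiplied into [D] by both [x] and [y]. *)
Lemma v_coprime_cancell {D : idomainType} (x y t c : D) :
  y != 0 -> v_coprime x y -> x * t = y * c -> exists r, t = y * r.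
Proof.
move=> y0 xy E.
have fy0 : FracField.tofrac y != 0 by rewrite tofrac_eq0.
have [||r _ rE] := v_coprime_integral x y
  (FracField.tofrac t / FracField.tofrac y) xy.
- exists c => //; apply: (mulfI fy0).
  by rewrite -rmorphM /= -E rmorphM /= mulrAC mulrCA divff // mulr1 mulrC.
- by exists t; rewrite // divfK.
exists r; apply/eqP; rewrite -tofrac_eq.
by rewrite rmorphM /= rE mulrC divfK.
Qed.

Lemma v_coprimeC {D : idomainType} (x y : D) :
  v_coprime x y -> v_coprime y x.
Proof.
rewrite /v_coprime => <-; congr (v_closure (frac_image _)).
by apply/seteqP; split=> z /ideal_pairP[r [s ->]]; apply/ideal_pairP;
  exists s, r; rewrite addrC.
Qed.

Lemma v_coprime_cancelr {D : idomainType} (x y t c : D) :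
  x != 0 -> v_coprime x y -> y * t = x * c -> exists r, t = x * r.
Proof. by move=> x0 /v_coprimeC; apply: v_coprime_cancell. Qed.

(** If a x = x^2 r + y s, then x (a - x r) is in yD, and [x] cancels modulo
    [y]. *)
Lemma v_coprime_colon_sub {D : idomainType} (x y a : D) :
  y != 0 -> v_coprime x y ->
  ideal_add (principal_ideal (x ^+ 2)) (principal_ideal y) (a * x) ->
  ideal_add (principal_ideal x) (principal_ideal y) a.
Proof.
move=> y0 xy /ideal_pairP[r [s E]].
have [|u uE] := v_coprime_cancell x y (a - x * r) s y0 xy.
  by rewrite mulrBr [x * a]mulrC E; ring.
by apply/ideal_pairP; exists r, u; rewrite -uE addrC subrK.
Qed.

Theorem proposition10 (D : idomainType) (x y : D) :
  sharp_domain D -> x != 0 -> y != 0 -> v_coprime x y ->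
  ideal_add (principal_ideal x) (principal_ideal y) = [set: D].
Proof.
move=> sharpD x0 y0 xy.
set J := ideal_add _ _.
have Jx : J x by apply/ideal_pairP; exists 1, 0; ring.
pose I := ideal_add (principal_ideal (x ^+ 2)) (principal_ideal y).
have JJ_I : ideal_mul J J `<=` I.
  apply: ideal_mul_sub; first exact: ideal_pair_is_ideal.
  move=> _ _ /ideal_pairP[r [s ->]] /ideal_pairP[u [v ->]].
  by apply/ideal_pairP; exists (r * u), (x * r * v + s * (x * u + y * v)); ring.
have [A' [B' [_ _ JA' JB' IE]]] := sharpD I J J (ideal_pair_nonzero _ _ y0)
  (ideal_pair_nonzero _ _ y0) (ideal_pair_nonzero _ _ y0) JJ_I.
have A'J a : A' a -> J a.
  move=> A'a; apply: v_coprime_colon_sub => //.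
  by rewrite -/I IE; apply: mem_ideal_mul => //; apply: JB'.
have B'J b : B' b -> J b.
  move=> B'b; apply: v_coprime_colon_sub => //.
  by rewrite -/I IE mulrC; apply: mem_ideal_mul => //; apply: JA'.
have : ideal_add (principal_ideal x) (principal_ideal (y ^+ 2)) y.
  have : I y by apply/ideal_pairP; exists 0, 1; ring.
  rewrite IE; apply: ideal_mul_sub; first exact: ideal_pair_is_ideal.
  move=> _ _ /A'J/ideal_pairP[r [s ->]] /B'J/ideal_pairP[u [v ->]].
  by apply/ideal_pairP; exists (r * (x * u + y * v) + y * s * u), (s * v); ring.
case/ideal_pairP=> r [s yE].
have [|u uE] := v_coprime_cancelr x y (1 - y * s) r x0 xy.
  by rewrite mulrBr mulr1 {1}yE; ring.
have J1 : J 1 by apply/ideal_pairP; exists u, s; rewrite -uE subrK.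
have [_ _ JM] := ideal_pair_is_ideal x y.
by apply/seteqP; split=> // z _; rewrite -[z]mulr1; apply: JM.
Qed.
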